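(* Let $c,L,\xi>0$, $N\in\mathbb{N}$ and $h=\frac{L}{N+1}$. There exists a constant $\delta$ with $$0<\delta<\frac{2\xi c^2}{L\left[c^2\left(1+\frac{1}{2N+2}\right)+\xi^2\right]}<\frac{2\xi c^2}{L\left[c^2+\xi^2\right]}$$ such that for all initial conditions $\vec v^0,\vec v^1\in\mathbb{R}^{N+2}$, the energy $E_h^{FD}(t)$ of the corresponding solution of the finite difference system satisfies $$E_h^{FD}(t)\le \frac{c+\delta L}{c-\delta L}\,e^{-\delta\left(1-\frac{L\delta}{c}\right)\left(1-\frac{\kappa^{FD}}{4c^2}\right)t}\,E_h^{FD}(0),\qquad \forall t>0.$$
   Context: Finite difference system (semi-discretization of the boundary-damped wave equation on $(0,L)$): for real functions $v_0(t),\dots,v_{N+1}(t)$, $t\ge0$, $$\ddot v_j-c^2\frac{v_{j+1}+v_{j-1}-2v_j}{h^2}=0\ (1\le j\le N),\qquad v_0=0,\qquad \ddot v_{N+1}+c^2\frac{v_{N+1}-v_N}{h^2}+\frac{\xi}{h}\dot v_{N+1}=0,$$ with initial data $v_j(0)=v_j^0$, $\dot v_j(0)=v_j^1$, $j=0,\dots,N+1$, where $\vec v^0=(v^0_0,\dots,v^0_{N+1})$, $\vec v^1=(v^1_0,\dots,v^1_{N+1})$ are compatible with $v_0\equiv0$ (i.e. $v^0_0=v^1_0=0$). Energy: $$E_h^{FD}(t)=\frac h2\sum_{j=0}^{N+1}|\dot v_j|^2+\frac{c^2h}{2}\sum_{j=0}^{N}\left|\frac{v_{j+1}-v_j}{h}\right|^2.$$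 $\kappa^{FD}=\max h^2|\lambda|^2$, the maximum being over the eigenvalues $\lambda=\lambda_j^{FD}(\xi,h)$ of the real $(2N+2)\times(2N+2)$ matrix $\mathcal{A}_h^{FD}(\xi)$ that writes the system in first-order form $\frac{d}{dt}(\vec u_1,\vec u_2)=\mathcal{A}_h^{FD}(\xi)(\vec u_1,\vec u_2)=(\vec u_2,-A_h\vec u_1+B_h\vec u_2)$ with $\vec u_1=(v_1,\dots,v_{N+1})^{\rm T}$, $\vec u_2=(\dot v_1,\dots,\dot v_{N+1})^{\rm T}$. Here $A_h$ is $\frac{c^2}{h^2}$ times the $(N+1)\times(N+1)$ tridiagonal matrix with off-diagonal entries $-1$, diagonal entries $2$ in rows $1,\dots,N$ and $1$ in row $N+1$; the only nonzero entry of $B_h$ is $(B_h)_{N+1,N+1}=-\xi/h$. *)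

(* Defs.v *)
From HB Require Import structures.
From mathcomp Require Import all_boot all_order all_algebra.
From mathcomp Require Import all_classical all_reals all_analysis.
From mathcomp Require Import complex.

Set Implicit Arguments.
Unset Strict Implicit.
Unset Printing Implicit Defensive.

Import Order.TTheory GRing.Theory Num.Theory.
Import numFieldNormedType.Exports ComplexField.Normc.

Local Open Scope classical_set_scope.
Local Open Scope ring_scope.

Definition mesh {R : realType} (L : R) (N : nat) : R := L / N.+1%:R.

(* Differentiation in the domain [0, +oo[: two-sided when t > 0, from the right
   when t = 0; the values of f at negative times are irrelevant. *)
Definition has_deriv_halfline {R : realType} (f : R -> R) (t l : R) : Prop :=
  (f s - f t) / (s - t) @[s --> within [set s | 0 <= s] t^'] --> l.

(* Components are indexed by nat; only the indices 0, ..., N+1 are constrained.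
   dv j and ddv j are the first and second time derivatives of v j. *)
Record FD_solution {R : realType} (c L xi : R) (N : nat) (v0 v1 : 'rV[R]_N.+2)
    (v dv ddv : nat -> R -> R) : Prop := MkFDSolution {
  FD_velocity : forall (j : nat) (t : R), (j <= N.+1)%N -> 0 <= t ->
    has_deriv_halfline (v j) t (dv j t);
  FD_acceleration : forall (j : nat) (t : R), (j <= N.+1)%N -> 0 <= t ->
    has_deriv_halfline (dv j) t (ddv j t);
  FD_interior : forall (j : nat) (t : R), (1 <= j <= N)%N -> 0 <= t ->
    ddv j t - c ^+ 2 * ((v j.+1 t + v j.-1 t - 2 * v j t) / mesh L N ^+ 2) = 0;
  FD_left : forall t : R, 0 <= t -> v 0%N t = 0;
  FD_right : forall t : R, 0 <= t ->
    ddv N.+1 t + c ^+ 2 * ((v N.+1 t - v N t) / mesh L N ^+ 2)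
      + xi / mesh L N * dv N.+1 t = 0;
  FD_position0 : forall j : 'I_N.+2, v j 0 = v0 ord0 j;
  FD_velocity0 : forall j : 'I_N.+2, dv j 0 = v1 ord0 j }.

Definition energyFD {R : realType} (c L : R) (N : nat) (v dv : nat -> R -> R)
    (t : R) : R :=
  mesh L N / 2 * (\sum_(0 <= j < N.+2) `|dv j t| ^+ 2)
  + c ^+ 2 * mesh L N / 2 *
    (\sum_(0 <= j < N.+1) `|(v j.+1 t - v j t) / mesh L N| ^+ 2).

(* Row and column i : 'I_N.+1 stand for the unknown v_(i+1). *)
Definition stiffness {R : realType} (c L : R) (N : nat) : 'M[R]_N.+1 :=
  (c ^+ 2 / mesh L N ^+ 2) *:
  \matrix_(i, j) (if i == j then (if (i : nat) == N then 1 else 2)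
                  else if ((i : nat) == j.+1) || ((j : nat) == i.+1) then - 1
                  else 0).

Definition damping {R : realType} (L xi : R) (N : nat) : 'M[R]_N.+1 :=
  (- (xi / mesh L N)) *: delta_mx ord_max ord_max.

(* Acts on column vectors col_mx u1 u2. *)
Definition generatorFD {R : realType} (c L xi : R) (N : nat) :
    'M[R]_(N.+1 + N.+1) :=
  block_mx 0 1%:M (- stiffness c L N) (damping L xi N).

(* eigenvalue refers to row eigenvectors, whence the transpose. *)
Definition spectrumFD {R : realType} (c L xi : R) (N : nat) : set R[i] :=
  [set l | eigenvalue (map_mx (real_complex R) (generatorFD c L xi N))^T l].

(* The supremum is a maximum, by kappaFD_max below. *)
Definition kappaFD {R : realType} (c L xi : R) (N : nat) : R :=
  sup [set mesh L N ^+ 2 * normc l ^+ 2 | l in spectrumFD c L xi N].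

Lemma kappaFD_max {R : realType} (c L xi : R) (N : nat) :
  (exists2 l, spectrumFD c L xi N l &
     kappaFD c L xi N = mesh L N ^+ 2 * normc l ^+ 2) /\
  (forall l, spectrumFD c L xi N l ->
     mesh L N ^+ 2 * normc l ^+ 2 <= kappaFD c L xi N).
Proof.
rewrite /kappaFD /spectrumFD.
set M := _^T; set g := fun l : R[i] => mesh L N ^+ 2 * normc l ^+ 2.
pose p := char_poly M.
have eigE l : eigenvalue M l = root p l by rewrite eigenvalue_root_char.
have [rs pE] := closed_field_poly_normal p.
have p0 : lead_coef p != 0 by rewrite lead_coef_eq0 monic_neq0 ?char_poly_monic.
have memE l : eigenvalue M l = (l \in rs).
  by rewrite eigE pE rootZ // root_prod_XsubC.
have /closed_rootP[l0] : size p != 1 by rewrite size_char_poly.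
rewrite -eigE memE => l0rs.
have [l1 l1rs l1max] : exists2 l1, l1 \in rs & forall l, l \in rs -> g l <= g l1.
  elim: rs l0 l0rs {pE memE} => // a s IH _ _.
  case: s IH => [_|b s IH].
    by exists a; rewrite ?mem_head// => l; rewrite inE => /eqP ->.
  have [l1 l1s l1max] := IH b (mem_head _ _).
  have [le|lt] := leP (g a) (g l1).
    exists l1; first by rewrite inE l1s orbT.
    by move=> l; rewrite inE => /orP[/eqP ->|/l1max].
  exists a; rewrite ?mem_head// => l; rewrite inE => /orP[/eqP -> //|/l1max].
  by move=> /le_trans; apply; exact: ltW.
have ub : ubound [set g l | l in [set l | eigenvalue M l]] (g l1).
  by move=> _ [l /= + <-]; rewrite memE; exact: l1max.
have in1 : [set g l | l in [set l | eigenvalue M l]] (g l1).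
  by exists l1 => //=; rewrite memE.
have supE : sup [set g l | l in [set l | eigenvalue M l]] = g l1.
  apply/eqP; rewrite eq_le; apply/andP; split.
    by apply: ge_sup => //; exists (g l1).
  by apply: ub_le_sup => //; exists (g l1).
split; first by exists l1 => //=; rewrite memE.
by move=> l /=; rewrite memE => lrs; rewrite supE; exact: l1max.
Qed.

(* Main.v *)
Require Import Defs.
From HB Require Import structures.
From mathcomp Require Import all_boot all_order all_algebra.
From mathcomp Require Import all_classical all_reals all_analysis.
From mathcomp Require Import complex.
From mathcomp Require Import ring lra zify.
Import Order.TTheory GRing.Theory Num.Theory.
Import numFieldNormedType.Exports.
Local Open Scope classical_set_scope.
Local Open Scope ring_scope.

(** Since [delta] may depend on [N], it suffices that the energy [E] contracts by
a fixed factor [q < 1] over a time interval of length [T = L / c]. Put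
[h = mesh L N], [s = c / h], [b = xi / h]. Read from the damped end, the
velocities and the scaled strains [s (v_(j+1) - v_j)] form a chain
[x_1, ..., x_m] with [x_k' = s (x_(k-1) - x_(k+1))], [x_(m+1) = 0] and
[x_0 = - (b / s) x_1]; moreover [E = h / 2 * sum x_k ^ 2] and [E' = - xi x_1 ^ 2].
Let [phi] be a cutoff vanishing at both ends of the interval. The derivative of
[phi ^ (2 k) x_(k-1) x_k] is, with [y_k = phi ^ k x_k], at most
[- s / 2 y_k ^ 2 + K (y_(k-1) ^ 2 + y_(k-2) ^ 2) + e y_(k+1) ^ 2], where [e] is as
small as desired; each factor [phi ^ 2] pays for one differentiation of the cutoff.
Combining these for [k = 2, ..., m] controls every [x_k] by [x_1], that is, by
the dissipation. Finally [delta T = delta L / c], and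
[exp y <= 1 / (1 - y) <= (1 + y) / (1 - y)] gives the prefactor; about [kappaFD]
only its sign matters. *)

(** * Calculus on the half-line *)

Lemma is_derive_nonincreasing {R : realType} (f df : R -> R) (a b : R) :
  a <= b -> (forall t, a <= t <= b -> is_derive t 1 f (df t)) ->
  (forall t, a <= t <= b -> df t <= 0) -> f b <= f a.
Proof.
move=> ab fd df0.
have cf : {within `[a, b], continuous f}.
  apply: derivable_within_continuous => t; rewrite in_itv/= => tab.
  by have [] := fd _ tab.
have fdo t : t \in `]a, b[ -> is_derive t 1 f (df t).
  by rewrite in_itv/= => /andP[/ltW at_ /ltW tb]; apply: fd; rewrite at_.
have [t tab E] := MVT_segment ab fdo cf.
rewrite -subr_le0 E; apply: mulr_le0_ge0; last by rewrite subr_ge0.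
by apply: df0; move: tab; rewrite in_itv.
Qed.

(** Near a positive time the constraint [0 <= s] holds automatically, so the half-line quotient is
    the ordinary one. *)
Lemma has_deriv_is_derive {R : realType} {f : R -> R} {t l : R} :
  0 < t -> has_deriv_halfline f t l -> is_derive t 1 f l.
Proof.
move=> t0 H; apply/is_derive1_caratheodory.
exists (fun z => if z == t then l else (f z - f t) / (z - t)); split.
- move=> z; case: eqVneq => [->|zt]; first by rewrite !subrr mulr0.
  by rewrite divfK// subr_eq0.
- apply/continuous_withinNx; rewrite eqxx => U /= /H /= HU.
  have t_ge0 : \forall z \near t^', 0 <= z.
    by apply: nbhs_dnbhs; near do apply: ltW; exact: lt_nbhsr.
  have zt : \forall z \near t^', z != t by exact: nbhs_dnbhs_neq.
  have {}HU : \forall z \near t^', 0 <= z -> U ((f z - f t) / (z - t)).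
    exact: HU.
  suff : \forall z \near t^',
    U (if z == t then l else (f z - f t) / (z - t)) by [].
  by apply: filterS3 HU t_ge0 zt => z Uz z0 /negbTE ->; exact: Uz.
- by rewrite eqxx.
Unshelve. all: by end_near.
Qed.

(** Needed because all chain estimates start at a positive time and are pushed to time [0] by a
    limit. *)
Lemma has_deriv_right_continuous {R : realType} (f : R -> R) (l : R) :
  has_deriv_halfline f 0 l -> (f s @[s --> 0^'+] --> f 0).
Proof.
move=> H.
have Hq : ((f s - f 0) / (s - 0) @[s --> 0^'+] --> l).
  move=> U /H /= HU.
  have {}HU : \forall s \near (0 : R), s != 0 -> 0 <= s ->
    U ((f s - f 0) / (s - 0)) by exact: HU.
  suff : \forall s \near (0 : R), 0 < s -> U ((f s - f 0) / (s - 0)) by [].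
  by apply: filterS HU => s Us s0; apply: Us; [rewrite gt_eqF | exact: ltW].
have Hs : ((s : R) @[s --> 0^'+] --> (0:R)).
  by apply: cvg_at_right_filter; exact: cvg_id.
have Hc : (f s - f 0) / (s - 0) * s + f 0 @[s --> 0^'+] --> f 0.
  rewrite -[X in _ --> X]add0r -[X in X + _](mulr0 l).
  by apply: cvgD (cvg_cst _); exact: cvgM.
apply: cvg_trans Hc; apply: near_eq_cvg; near=> s.
have s0 : 0 < s by near: s; exact: nbhs_right_gt.
by rewrite subr0 /= divfK ?gt_eqF// subrK.
Unshelve. all: by end_near.
Qed.

(** * Chains and cutoff multipliers *)

Definition chain_solution {R : realType} (s : R) (m : nat)
    (x : nat -> R -> R) : Prop :=
  forall (k : nat) (t : R), (1 <= k <= m)%N -> 0 < t ->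
    is_derive t 1 (x k) (s * (x k.-1 t - x k.+1 t)).

Definition cutoff {R : realType} (a T t : R) : R := (t - a) * (a + T - t).

Lemma cutoff_bounds {R : realType} {a T t : R} : a <= t <= a + T ->
  0 <= cutoff a T t <= T ^+ 2.
Proof. by move=> /andP[at_ tT]; rewrite /cutoff; apply/andP; split; nra. Qed.

(** The exponent equals the index so that, when the cutoff in [phi ^ (2 k) x_(k-1) x_k] is
    differentiated, the remaining [phi ^ (2 k - 1)] splits exactly into the weights of [y_(k-1)] and
    [y_k]. *)
Definition windowed {R : realType} (a T : R) (x : nat -> R -> R) (t : R)
    (j : nat) : R := cutoff a T t ^+ j * x j t.

Lemma is_derive_cutoff {R : realType} (a T t : R) :
  is_derive t 1 (cutoff a T) (2 * a + T - 2 * t).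
Proof.
have -> : cutoff a T = (id - cst a) * (cst (a + T) - id) by apply/funext.
by apply: is_derive_eq; rewrite /= /GRing.scale/= !fctE; ring.
Qed.

(** Young's inequality with weight [q], by completing the square. *)
Lemma mul2_le_sqrD {R : realFieldType} (q u v : R) : 0 < q ->
  u * v <= q * v ^+ 2 + u ^+ 2 / (4 * q).
Proof.
move=> q0; rewrite -subr_ge0.
have -> : q * v ^+ 2 + u ^+ 2 / (4 * q) - u * v = (2 * q * v - u) ^+ 2 / (4 * q).
  by field; rewrite gt_eqF.
by rewrite divr_ge0 ?sqr_ge0 ?mulr_ge0 ?ltW.
Qed.

(** Young's inequality spends [s / 4 * y2 ^ 2] on each of the two products containing [y2], half of
    the available [- s * y2 ^ 2], and [e * y3 ^ 2] on the last product. [K] does not depend on the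
    [y]'s or on the position of the window. *)
Lemma chain_crossterm_le {R : realFieldType} (s T e : R) (k : nat) :
  0 < s -> 0 <= T -> 0 < e -> exists2 K : R, 0 <= K &
  forall phi dphi y0 y1 y2 y3 : R, 0 <= phi <= T ^+ 2 -> `|dphi| <= T ->
    2 * k%:R * dphi * (y1 * y2) +
    s * (phi ^+ 2 * y1 ^+ 2 - y2 ^+ 2 + phi ^+ 2 * (y0 * y2) - y1 * y3) <=
    - (s / 2 * y2 ^+ 2) + K * (y1 ^+ 2 + y0 ^+ 2) + e * y3 ^+ 2.
Proof.
move=> s0 T0 e0.
(* The summands pay, in order, for the derivative of the cutoff, for [phi ^ 2 y1 ^ 2], for
   [phi ^ 2 y0 y2] and for [y1 y3]. *)
exists ((2 * k%:R * T) ^+ 2 / s + s * T ^+ 4 + s * T ^+ 8 + s ^+ 2 / (4 * e)).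
  by rewrite !addr_ge0// ?divr_ge0 ?mulr_ge0 ?exprn_ge0// ?ltW// !mulr_ge0.
move=> p d y0 y1 y2 y3 /andP[p0 pT] dT.
have p2 : p ^+ 2 <= T ^+ 4.
  by rewrite (exprM T 2 2) lerXn2r// nnegrE ?exprn_ge0.
have p4 : (p ^+ 2) ^+ 2 <= T ^+ 8.
  by rewrite (exprM T 4 2) lerXn2r// nnegrE ?exprn_ge0.
have d2 : (2 * k%:R * d) ^+ 2 / s <= (2 * k%:R * T) ^+ 2 / s.
  rewrite ler_pM2r ?invr_gt0// (exprMn _ _ d) (exprMn _ _ T).
  by rewrite ler_wpM2l ?sqr_ge0// -(real_normK (num_real d)) lerXn2r// nnegrE.
have s4 : 0 < s / 4 by rewrite divr_gt0.
have hA := @mul2_le_sqrD R (s / 4) (2 * k%:R * d * y1) y2 s4.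
have hB := @mul2_le_sqrD R (1 / 4) (p ^+ 2 * y0) y2 ltac:(by rewrite divr_gt0).
have hC := @mul2_le_sqrD R e (- s * y1) y3 e0.
have {}hA : 2 * k%:R * d * (y1 * y2) <=
    s / 4 * y2 ^+ 2 + (2 * k%:R * T) ^+ 2 / s * y1 ^+ 2.
  rewrite mulrA; apply: le_trans hA _; rewrite lerD2l.
  apply: le_trans (ler_wpM2r (sqr_ge0 y1) d2).
  by rewrite le_eqVlt; apply/orP; left; apply/eqP; field; rewrite gt_eqF.
have {}hB : s * (p ^+ 2 * (y0 * y2)) <= s / 4 * y2 ^+ 2 + s * T ^+ 8 * y0 ^+ 2.
  have := ler_wpM2r (sqr_ge0 y0) p4; move: hB; clear -s0; nra.
have {}hC : - (s * (y1 * y3)) <= e * y3 ^+ 2 + s ^+ 2 / (4 * e) * y1 ^+ 2.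
  rewrite mulrA -mulNr -mulNr; apply: le_trans hC _; rewrite lerD2l.
  by rewrite exprMn sqrrN mulrAC.
have hD : s * (p ^+ 2 * y1 ^+ 2) <= s * T ^+ 4 * y1 ^+ 2.
  by rewrite -mulrA ler_pM2l// ler_wpM2r// sqr_ge0.
(* [K] multiplies both squares while each estimate above uses one of them; the four surplus terms
   are nonnegative. *)
have : 0 <= (2 * k%:R * T) ^+ 2 / s * y0 ^+ 2.
  by rewrite mulr_ge0 ?sqr_ge0// divr_ge0 ?sqr_ge0 ?ltW.
have : 0 <= s * T ^+ 4 * y0 ^+ 2 
  by rewrite mulr_ge0 ?sqr_ge0 ?mulr_ge0 ?exprn_ge0 ?(ltW s0).
have : 0 <= s * T ^+ 8 * y1 ^+ 2 
  by rewrite mulr_ge0 ?sqr_ge0 ?mulr_ge0 ?exprn_ge0 ?(ltW s0).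
have : 0 <= s ^+ 2 / (4 * e) * y0 ^+ 2.
  by rewrite mulr_ge0 ?sqr_ge0// divr_ge0 ?sqr_ge0 ?mulr_ge0 ?ltW.
move: ((2 * k%:R * T) ^+ 2 / s) (s ^+ 2 / (4 * e)) hA hB hC hD => A C.
move: (2 * k%:R * d * (y1 * y2)) (T ^+ 4) (T ^+ 8) => D T4 T8.
clear; lra.
Qed.

Lemma is_derive_crossterm {R : realType} (s a T : R) (m k : nat)
    (x : nat -> R -> R) (t : R) :
  chain_solution s m x -> (2 <= k <= m)%N -> 0 < t ->
  let phi := cutoff a T t in let y := windowed a T x t in
  is_derive t 1 (fun t => cutoff a T t ^+ (2 * k) * (x k.-1 t * x k t))
    (2 * k%:R * (2 * a + T - 2 * t) * (y k.-1 * y k) +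
     s * (phi ^+ 2 * y k.-1 ^+ 2 - y k ^+ 2 + phi ^+ 2 * (y k.-2 * y k)
          - y k.-1 * y k.+1)).
Proof.
move=> hx + t0; case: k => [|[|k]]; [by []|by []|move=> hk].
have h1 : is_derive t 1 (x k.+1) _ := hx k.+1 t ltac:(lia) t0.
have h2 : is_derive t 1 (x k.+2) _ := hx k.+2 t ltac:(lia) t0.
have h3 := is_derive_cutoff a T t.
have -> : (2 * k.+2 = (2 * k + 3).+1)%N by lia.
rewrite (_ : (fun _ => _) = cutoff a T ^+ (2 * k + 3).+1 * (x k.+1 * x k.+2)).
  2: by apply/funext => u; rewrite !fctE.
apply: (is_derive_eq (is_deriveM (is_deriveX _ h3) (is_deriveM h1 h2))).
rewrite /GRing.scale/= !fctE /windowed; move: (cutoff a T t) => p.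
rewrite !(exprS _ (2 * k + 3)) exprD mulnC exprM !(exprS _ k.+2) !(exprS _ k.+1).
rewrite !(exprS _ k) (_ : (k * 2 + 3).+1%:R = 2 * k.+2%:R); first by ring.
by rewrite -natrM; congr _%:R; lia.
Qed.

(** Induction on [k]: the cross term of the next index is added to a large multiple of the previous
    [F], which pays for its [K] terms. Every cross term carries the cutoff, so [F] vanishes at both
    ends. [C] is chosen before [x] and [a], which makes the later contraction factor uniform. *)
Lemma chain_multiplier {R : realType} (s T : R) (m k : nat) :
  0 < s -> 0 < T -> (1 <= k <= m)%N -> forall e : R, 0 < e ->
  exists2 C : R, 0 <= C &
  forall (x : nat -> R -> R) (a : R), chain_solution s m x -> 0 < a ->
  exists F dF : R -> R, [/\ F a = 0, F (a + T) = 0,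
    forall t, a <= t <= a + T -> is_derive t 1 F (dF t) &
    forall t, a <= t <= a + T ->
      let y := windowed a T x t in
      dF t <= - (\sum_(1 <= j < k.+1) y j ^+ 2) +
              C * (y 0%N ^+ 2 + y 1%N ^+ 2) + e * y k.+1 ^+ 2].
Proof.
move=> s0 T0; elim: k => // -[_|k IH] /= hk e e0.
  (* For [k = 1] the zero multiplier works: with [C = 1] the sum [y_1 ^ 2] cancels. *)
  exists 1 => // x a _ _; exists (cst 0), (cst 0); split => // t _.
    exact: is_derive_cst.
  rewrite big_nat1 /cst mul1r addrCA addNr addr0.
  by apply: addr_ge0 (sqr_ge0 _) (mulr_ge0 (ltW e0) (sqr_ge0 _)).
have [|K K0 HK] := @chain_crossterm_le R s T (e * s / 4) k.+2 s0 (ltW T0).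
  by rewrite divr_gt0 ?mulr_gt0.
(* Scaling by [A] turns [- s / 2] into [- 2] and the error [e * s / 4] into [e]. The induction
   hypothesis is used with error [B^-1], hence after scaling by [B] it costs one [y_(k+2) ^ 2] out
   of these two; the part [A * K] of [B] absorbs the lower squares. *)
pose A := 4 / s; pose B := 1 + A * K.
have A0 : 0 < A by rewrite divr_gt0.
have AK : 0 <= A * K by apply: mulr_ge0 => //; exact: ltW.
have B0 : 0 < B by apply: ltr_pwDl.
have hk' : (1 <= k.+1 <= m)%N by lia.
have [|C C0 HC] := IH hk' B^-1; first by rewrite invr_gt0.
exists (B * C + A * K); first by apply: addr_ge0 => //; exact: mulr_ge0 (ltW B0) C0.
move=> x a hx a0; have [F [dF [Fa FT FD Fle]]] := HC x a hx a0.
pose G t := cutoff a T t ^+ (2 * k.+2) * (x k.+1 t * x k.+2 t).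
pose dG t := let phi := cutoff a T t in let y := windowed a T x t in
  2 * k.+2%:R * (2 * a + T - 2 * t) * (y k.+1 * y k.+2) +
  s * (phi ^+ 2 * y k.+1 ^+ 2 - y k.+2 ^+ 2 + phi ^+ 2 * (y k * y k.+2)
       - y k.+1 * y k.+3).
exists (B *: F + A *: G), (fun t => B * dF t + A * dG t); split.
- by rewrite !fctE Fa /G /cutoff subrr mul0r expr0n/= mul0r !scaler0 addr0.
- by rewrite !fctE FT /G /cutoff subrr mulr0 expr0n/= mul0r !scaler0 addr0.
- move=> t tab; have hF := FD t tab.
  have t0 : 0 < t by case/andP: tab => + _; exact: lt_le_trans.
  have hG : is_derive t 1 G (dG t) by apply: is_derive_crossterm hx _ t0; lia.
  exact: is_deriveD.
move=> t tab; have := Fle t tab; set y := windowed a T x t => {}Fle.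
(* The term [y 0 ^ 2] is added because for [k = 0] the square [y k ^ 2] lies outside the sum. *)
have yle : y k.+1 ^+ 2 + y k ^+ 2 <= \sum_(1 <= j < k.+2) y j ^+ 2 + y 0%N ^+ 2.
  have -> : \sum_(1 <= j < k.+2) y j ^+ 2 + y 0%N ^+ 2 = \sum_(0 <= j < k.+2) y j ^+ 2.
    by rewrite [RHS]big_ltn// addrC.
  rewrite addrC big_nat_recr//= lerD2r big_nat_recr//=.
  by rewrite lerDr sumr_ge0// => j _; exact: sqr_ge0.
have dGle : A * dG t <=
    - (2 * y k.+2 ^+ 2) + A * K * (y k.+1 ^+ 2 + y k ^+ 2) + e * y k.+3 ^+ 2.
  have -> : - (2 * y k.+2 ^+ 2) + A * K * (y k.+1 ^+ 2 + y k ^+ 2)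
      + e * y k.+3 ^+ 2 = A * (- (s / 2 * y k.+2 ^+ 2) +
        K * (y k.+1 ^+ 2 + y k ^+ 2) + e * s / 4 * y k.+3 ^+ 2).
    by rewrite /A; field; rewrite gt_eqF.
  rewrite ler_pM2l//; apply: HK; first exact: cutoff_bounds.
  by case/andP: tab => at_ tT; rewrite ler_norml; apply/andP; split; lra.
have {}yle := ler_wpM2l AK yle.
have {}Fle := ler_wpM2l (ltW B0) Fle.
have y1 : 0 <= A * K * y 1%N ^+ 2 by rewrite mulr_ge0 ?sqr_ge0.
rewrite big_nat_recr//=.
rewrite !mulrDr mulVKf ?gt_eqF// in Fle.
move: Fle dGle yle; rewrite /B; move: (A * K) y1 => D y1.
move: (\sum_(1 <= j < k.+2) y j ^+ 2) (A * dG t) (dF t) => S G' F'.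
lra.
Qed.

(** * Energy and contraction of the damped chain *)

Definition chain_energy {R : realType} (m : nat) (x : nat -> R -> R) (t : R) : R :=
  \sum_(1 <= j < m.+1) x j t ^+ 2.

Lemma chain_energy_ge0 {R : realType} (m : nat) (x : nat -> R -> R) (t : R) :
  0 <= chain_energy m x t.
Proof. by apply: sumr_ge0 => j _; exact: sqr_ge0. Qed.

(** The products of neighbours telescope, leaving only the fluxes at the two ends. *)
Lemma is_derive_chain_energy {R : realType} {s : R} {m : nat}
    {x : nat -> R -> R} {t : R} : chain_solution s m x -> 0 < t ->
  is_derive t 1 (chain_energy m x) (2 * s * (x 0%N t * x 1%N t - x m t * x m.+1 t)).
Proof.
move=> hx t0.
suff H k : (k <= m)%N -> is_derive t 1 (chain_energy k x)
    (2 * s * (x 0%N t * x 1%N t - x k t * x k.+1 t)) by exact: H.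
elim: k => [_|k IH km].
  rewrite subrr mulr0 (_ : chain_energy 0 x = cst 0); first exact: is_derive_cst.
  by apply/funext => u; rewrite /chain_energy big_geq.
have -> : chain_energy k.+1 x = chain_energy k x + x k.+1 ^+ 2.
  by apply/funext => u; rewrite /chain_energy big_nat_recr.
have hk := hx k.+1 t km t0.
apply: (is_derive_eq (is_deriveD (IH (ltnW km)) (is_deriveX 2 hk))).
by rewrite /GRing.scale/= !expr1; ring.
Qed.

(** The condition on [x 0] turns the first equation into [x_1' = - b x_1 - s x_2], friction at the
    first site; the other end is fixed. *)
Definition damped_chain {R : realType} (s b : R) (m : nat)
    (x : nat -> R -> R) : Prop :=
  [/\ chain_solution s m x, forall t, 0 < t -> x 0%N t = - (b / s) * x 1%N t &
      forall t, 0 < t -> x m.+1 t = 0].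

Lemma is_derive_damped_chain_energy {R : realType} {s b : R} {m : nat}
    {x : nat -> R -> R} {t : R} :
  0 < s -> damped_chain s b m x -> 0 < t ->
  is_derive t 1 (chain_energy m x) (- (2 * b * x 1%N t ^+ 2)).
Proof.
move=> s_gt0 [hx hl hr] t0.
apply: (is_derive_eq (is_derive_chain_energy hx t0)).
by rewrite hl// hr//; field; rewrite gt_eqF.
Qed.

Lemma damped_chain_energy_nonincreasing {R : realType} {s b : R} {m : nat}
    {x : nat -> R -> R} {a t : R} :
  0 < s -> 0 < b -> damped_chain s b m x -> 0 < a -> a <= t ->
  chain_energy m x t <= chain_energy m x a.
Proof.
move=> s_gt0 b_gt0 hx a0 at_; apply: is_derive_nonincreasing at_ _ _ => u /andP[au _].
  exact: is_derive_damped_chain_energy s_gt0 hx (lt_le_trans a0 au).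
by rewrite oppr_le0 mulr_ge0 ?sqr_ge0// mulr_ge0// ltW.
Qed.

(** [G = F + M S] decreases on the window, and on its middle third at rate at least
    [mu * S (a + T)]. As [F] vanishes at both ends, this reads [(M + kap) S (a + T) <= M S a]. *)
Lemma damped_chain_contraction {R : realType} {s b T : R} {m : nat} :
  0 < s -> 0 < b -> 0 < T -> (1 <= m)%N ->
  exists2 q : R, q < 1 & forall (x : nat -> R -> R) (a : R),
    damped_chain s b m x -> 0 < a ->
    chain_energy m x (a + T) <= q * chain_energy m x a.
Proof.
move=> s_gt0 b_gt0 T0 m0.
have hm : (1 <= m <= m)%N by rewrite m0 leqnn.
(* The error is a multiple of [y_(m+1) ^ 2], which vanishes at the fixed end, so [e = 1]
   suffices. *)
have [C C0 HC] := @chain_multiplier R s T m m s_gt0 T0 hm 1 ltr01.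
(* Makes [M] times the dissipation [2 b x_1 ^ 2] dominate [C (y_0 ^ 2 + y_1 ^ 2)], using
   [y_0 = - (b / s) x_1] and [phi <= T ^ 2]. *)
pose M := C * ((b / s) ^+ 2 + T ^+ 4) / (2 * b).
have M0 : 0 <= M.
  by rewrite divr_ge0 ?mulr_ge0 ?addr_ge0 ?sqr_ge0 ?exprn_ge0// ltW.
(* Lower bound for all weights [phi ^ (2 j)], [j <= m], on the middle third, where
   [phi >= T ^ 2 / 9]; the minimum with [1] lets the largest exponent serve for all [j]. *)
pose mu := Num.min 1 (T ^+ 2 / 9) ^+ (2 * m).
have min0 : 0 < Num.min 1 (T ^+ 2 / 9) by rewrite lt_min ltr01 divr_gt0 ?exprn_gt0.
have mu0 : 0 < mu by exact: exprn_gt0.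
pose kap := mu * (T / 3).
have kap0 : 0 < kap by rewrite mulr_gt0 ?divr_gt0.
exists (M / (M + kap)).
  by rewrite ltr_pdivrMr ?ltr_wpDl// mul1r ltrDl.
move=> x a hx a0; have [hc hl hr] := hx.
have T3 : 0 < T / 3 by rewrite divr_gt0.
have le2 : a + T / 3 <= a + 2 * T / 3 by lra.
have le3 : a + 2 * T / 3 <= a + T by lra.
have left_third t : a <= t <= a + T / 3 -> a <= t <= a + T.
  by move=> /andP[-> tT]; apply: le_trans tT _; lra.
have middle_third t : a + T / 3 <= t <= a + 2 * T / 3 -> a <= t <= a + T.
  by move=> /andP[at_ tT]; apply/andP; split; lra.
have right_third t : a + 2 * T / 3 <= t <= a + T -> a <= t <= a + T.
  by move=> /andP[at_ ->]; rewrite andbT; apply: le_trans at_; lra.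
have [F [dF [Fa FT FD Fle]]] := HC x a hc a0.
set S := chain_energy m x.
pose G := F + M *: S; pose dG t := dF t + M * - (2 * b * x 1%N t ^+ 2).
have GD t : a <= t <= a + T -> is_derive t 1 G (dG t).
  move=> tab; have hF := FD t tab.
  have t0 : 0 < t by case/andP: tab => + _; exact: lt_le_trans.
  have hS := is_derive_damped_chain_energy s_gt0 hx t0.
  exact: is_deriveD.
have dGle t : a <= t <= a + T ->
    dG t <= - (\sum_(1 <= j < m.+1) windowed a T x t j ^+ 2).
  move=> tab; have := Fle t tab; rewrite /=.
  have t0 : 0 < t by case/andP: tab => + _; exact: lt_le_trans.
  rewrite [windowed a T x t m.+1]/windowed hr// mulr0 expr0n/= mulr0 addr0.
  have /andP[p0 pT] := cutoff_bounds tab.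
  have p2 : cutoff a T t ^+ 2 <= T ^+ 4.
    by rewrite (exprM T 2 2) lerXn2r// nnegrE ?exprn_ge0// ltW.
  have : C * (windowed a T x t 0%N ^+ 2 + windowed a T x t 1%N ^+ 2) <=
      M * (2 * b * x 1%N t ^+ 2).
    have -> : M * (2 * b * x 1%N t ^+ 2) = C * (((b / s) ^+ 2 + T ^+ 4) * x 1%N t ^+ 2).
      by rewrite /M; field; rewrite !gt_eqF.
    rewrite ler_wpM2l// /windowed expr0 mul1r expr1 hl// mulNr sqrrN.
    rewrite (exprMn _ (b / s)) (exprMn _ (cutoff a T t)) mulrDl lerD2l.
    by apply: ler_wpM2r => //; exact: sqr_ge0.
  by rewrite /dG; lra.
have dG0 t : a <= t <= a + T -> dG t <= 0.
  move=> tab; apply: le_trans (dGle t tab) _.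
  by rewrite oppr_le0 sumr_ge0// => j _; exact: sqr_ge0.
have dGmid t : a + T / 3 <= t <= a + 2 * T / 3 -> dG t <= - (mu * S (a + T)).
  move=> tmid; have tab := middle_third t tmid; have /andP[at_ tT] := tmid.
  apply: le_trans (dGle t tab) _; rewrite lerN2.
  have t0 : 0 < t by lra.
  have St : S (a + T) <= S t.
    by apply: (damped_chain_energy_nonincreasing s_gt0 b_gt0 hx) => //; lra.
  apply: le_trans (ler_wpM2l (ltW mu0) St) _.
  rewrite /S /chain_energy mulr_sumr !big_nat ler_sum// => j /andP[j1 jm].
  rewrite /windowed exprMn ler_wpM2r ?sqr_ge0// -exprM mulnC.
  have pmin : Num.min 1 (T ^+ 2 / 9) <= cutoff a T t.
    by rewrite ge_min; apply/orP; right; rewrite /cutoff; nra.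
  apply: (@le_trans _ _ (Num.min 1 (T ^+ 2 / 9) ^+ (2 * j))).
    by apply: ler_wiXn2l; rewrite ?(ltW min0) ?ge_min ?lexx// leq_mul2l.
  by apply: lerXn2r => //; rewrite nnegrE; [exact: ltW | exact: le_trans (ltW min0) pmin].
have GE t : G t = F t + M * S t by [].
clearbody G.
have G1 : G (a + T / 3) <= G a.
  apply: (@is_derive_nonincreasing _ G dG a (a + T / 3)) => [|t tab|t tab].
  - by rewrite lerDl ltW.
  - by apply: GD; exact: left_third.
  - by apply: dG0; exact: left_third.
have G3 : G (a + T) <= G (a + 2 * T / 3).
  apply: (@is_derive_nonincreasing _ G dG (a + 2 * T / 3) (a + T)) => [|t tab|t tab].
  - exact: le3.
  - by apply: GD; exact: right_third.
  - by apply: dG0; exact: right_third.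
have G2 : G (a + 2 * T / 3) + mu * S (a + T) * (a + 2 * T / 3) <=
          G (a + T / 3) + mu * S (a + T) * (a + T / 3).
  (* Adding the linear function [c t] turns the bound on [dG] into monotonicity, in place of an
     integration. *)
  pose c := mu * S (a + T).
  have hD t : a + T / 3 <= t <= a + 2 * T / 3 ->
      is_derive t 1 (G + c *: id) (dG t + c).
    move=> tab; have hG := GD t (middle_third t tab).
    apply: (is_derive_eq (is_deriveD hG (is_deriveZ c (is_derive_id t 1)))).
    by rewrite /GRing.scale/= mulr1.
  have hD0 t : a + T / 3 <= t <= a + 2 * T / 3 -> dG t + c <= 0.
    by move=> tab; rewrite -lerBrDr sub0r; exact: dGmid.
  exact: is_derive_nonincreasing le2 hD hD0.
rewrite !GE Fa FT !add0r in G1 G2 G3.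
rewrite mulrAC ler_pdivlMr ?ltr_wpDl//.
by rewrite /kap; lra.
Qed.

(** * Exponential decay from contraction *)

(** Each full step of length [T] gains [q <= 1 - d T <= exp (- d T)]; the prefactor [exp (d T)]
    covers the last incomplete step, where only monotonicity is used. *)
Lemma geometric_decay {R : realType} (f : R -> R) (T q d : R) :
  0 < T -> 0 <= d -> d * T <= 1 - q -> (forall t, 0 <= f t) ->
  (forall a t, 0 < a -> a <= t -> f t <= f a) ->
  (forall a, 0 < a -> f (a + T) <= q * f a) ->
  forall a t, 0 < a -> a <= t -> f t <= expR (d * T - d * (t - a)) * f a.
Proof.
move=> T0 d0 dT f0 fle fq.
suff H n a t : 0 < a -> a <= t -> t <= a + n.+1%:R * T ->
    f t <= expR (d * T - d * (t - a)) * f a.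
  move=> a t a0 at_; have tn : t <= a + (Num.bound ((t - a) / T)).+1%:R * T.
    rewrite -lerBlDl -ler_pdivrMr//; apply: ltW.
    apply: lt_le_trans (archi_boundP _) _; last by rewrite ler_nat.
    by rewrite divr_ge0 ?subr_ge0// ltW.
  exact: H tn.
have short u w : 0 < u -> u <= w -> w <= u + T ->
    f w <= expR (d * T - d * (w - u)) * f u.
  move=> u0 uw wT; apply: le_trans (fle _ _ u0 uw) _.
  rewrite ler_peMl// -expR0 ler_expR -mulrBr mulr_ge0// subr_ge0 lerBlDl//.
elim: n a t => [|n IH] a t a0 at_ tn; first by apply: short; rewrite // mul1r in tn.
have [tT|Tt] := leP t (a + T); first exact: short.
apply: le_trans (IH (a + T) t _ (ltW Tt) _) _.
- by rewrite addr_gt0.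
- by move: tn; rewrite -[n.+2]addn1 natrD mulrDl mul1r; lra.
have q1 : q <= expR (- (d * T)).
  by apply: le_trans (expR_ge1Dx _); rewrite lerBrDr addrC -lerBrDr.
apply: le_trans (ler_wpM2l (expR_ge0 _) (fq a a0)) _.
apply: le_trans (ler_wpM2l (expR_ge0 _) (ler_wpM2r (f0 a) q1)) _.
rewrite mulrA -expRD le_eqVlt; apply/orP; left; apply/eqP; congr (expR _ * _).
by ring.
Qed.

(** * The finite difference system as a damped chain *)

(* Odd indices [2 (N+1-j) + 1] carry the velocity of node [j], even indices
[2 (N-j) + 2] the scaled strain between nodes [j] and [j+1]; index [0] is the
ghost value that encodes the boundary damping. *)
Definition FD_chain {R : realType} (s b : R) (N : nat) (v dv : nat -> R -> R)
    (k : nat) (t : R) : R :=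
  let i := (2 * N + 3 - k)%N in
  if k == 0%N then - (b / s) * dv N.+1 t
  else if odd i then s * (v i./2.+1 t - v i./2 t) else dv i./2 t.

Lemma FD_chain_strain {R : realType} (s b : R) (N j : nat) (v dv : nat -> R -> R) :
  (j <= N)%N ->
  FD_chain s b N v dv (2 * (N - j) + 2) = s *: (v j.+1 - v j).
Proof.
move=> jN; apply/funext => t; rewrite /FD_chain addn2 /=.
have -> : (2 * N + 3 - (2 * (N - j)).+2 = (2 * j).+1)%N by lia.
by rewrite /= mul2n odd_double /= uphalf_double.
Qed.

Lemma FD_chain_velocity {R : realType} (s b : R) (N j : nat) (v dv : nat -> R -> R) :
  (j <= N.+1)%N -> FD_chain s b N v dv (2 * (N.+1 - j) + 1) = dv j.
Proof.
move=> jN; apply/funext => t; rewrite /FD_chain addn1 /=.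
have -> : (2 * N + 3 - (2 * (N.+1 - j)).+1 = 2 * j)%N by lia.
by rewrite mul2n odd_double doubleK.
Qed.

(** Scaling strains by [c / h] gives kinetic and potential parts the same weight [h / 2]. Node [0]
    is at rest, which leaves [N+1] velocities and [N+1] strains. *)
Lemma FD_chain_energy {R : realType} (c L xi : R) (N : nat)
    (v dv : nat -> R -> R) (t : R) : 0 < L -> dv 0%N t = 0 ->
  energyFD c L N v dv t = mesh L N / 2 * chain_energy (2 * N + 2)
    (FD_chain (c / mesh L N) (xi / mesh L N) N v dv) t.
Proof.
move=> L0 dv0; have h0 : 0 < mesh L N by rewrite divr_gt0.
rewrite /energyFD /chain_energy.
set s := c / _; set b := xi / _; set h := mesh L N.
(* Splits the chain sum into pairs of an odd index (velocity) and an even one (strain). *)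
have H (g : nat -> R) n : \sum_(1 <= k < (2 * n).+1) g k =
    \sum_(0 <= j < n) (g (2 * j + 1)%N + g (2 * j + 2)%N).
  elim: n => [|n IH]; first by rewrite !big_geq.
  rewrite [RHS]big_nat_recr//= -IH (_ : (2 * n.+1).+1 = (2 * n).+3)%N; last by lia.
  by rewrite big_nat_recr//= big_nat_recr//= addrA addn1 addn2.
rewrite (_ : (2 * N + 2).+1 = (2 * N.+1).+1)%N; last by lia.
rewrite H [in RHS]big_nat_rev/= [X in h / 2 * X + _]big_ltn// dv0 normr0 expr0n/= add0r.
rewrite big_add1/= big_split/= mulrDr; congr (_ + _).
  congr (_ * _); rewrite !big_nat; apply: eq_bigr => j /andP[_ jN].
  rewrite (_ : (2 * (0 + N.+1 - j.+1) + 1 = 2 * (N.+1 - j.+1) + 1)%N); last by lia.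
  by rewrite FD_chain_velocity// real_normK ?num_real.
rewrite !mulr_sumr !big_nat; apply: eq_bigr => j /andP[_ jN].
rewrite (_ : (2 * (0 + N.+1 - j.+1) + 2 = 2 * (N - j) + 2)%N); last by lia.
rewrite FD_chain_strain// real_normK ?num_real// !fctE /GRing.scale/= /s -/h.
by field; rewrite gt_eqF.
Qed.

Lemma FD_velocity_left {R : realType} {c L xi : R} {N : nat}
    {v0 v1 : 'rV[R]_N.+2} {v dv ddv : nat -> R -> R} {t : R} :
  FD_solution c L xi v0 v1 v dv ddv -> v1 ord0 ord0 = 0 -> 0 <= t ->
  dv 0%N t = 0.
Proof.
move=> sol v10; rewrite le_eqVlt => /predU1P[<-|t0].
  by rewrite (FD_velocity0 sol ord0).
have [_ <-] := has_deriv_is_derive t0 (FD_velocity sol (leq0n _) (ltW t0)).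
have -> : 'D_1 (v 0%N) t = 'D_1 (cst 0 : R -> R) t.
  apply: near_eq_derive; near=> u; apply: (FD_left sol); apply: ltW.
  by near: u; exact: lt_nbhsr.
by rewrite derive_cst.
Unshelve. all: by end_near.
Qed.

Lemma FD_chain_damped {R : realType} {c L xi : R} {N : nat}
    {v0 v1 : 'rV[R]_N.+2} {v dv ddv : nat -> R -> R} :
  0 < c -> 0 < L -> FD_solution c L xi v0 v1 v dv ddv -> v1 ord0 ord0 = 0 ->
  damped_chain (c / mesh L N) (xi / mesh L N) (2 * N + 2)
    (FD_chain (c / mesh L N) (xi / mesh L N) N v dv).
Proof.
move=> c0 L0 sol v10; have h0 : 0 < mesh L N by rewrite divr_gt0.
set s := c / _; set b := xi / _; pose h := mesh L N.
have s0 : 0 < s by rewrite divr_gt0.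
set x := FD_chain s b N v dv.
have x0E (t : R) : x 0%N t = - (b / s) * dv N.+1 t by [].
have xS j : (j <= N)%N -> x (2 * (N - j) + 2)%N = s *: (v j.+1 - v j).
  exact: FD_chain_strain.
have xV j : (j <= N.+1)%N -> x (2 * (N.+1 - j) + 1)%N = dv j.
  exact: FD_chain_velocity.
have dvD j (t : R) : (j <= N.+1)%N -> 0 < t -> is_derive t 1 (dv j) (ddv j t).
  by move=> jN t0; apply: has_deriv_is_derive (FD_acceleration sol jN (ltW t0)).
have vD j (t : R) : (j <= N.+1)%N -> 0 < t -> is_derive t 1 (v j) (dv j t).
  by move=> jN t0; apply: has_deriv_is_derive (FD_velocity sol jN (ltW t0)).
split=> [k t /andP[k1 km] t0|t t0|t t0]; last 2 first.
- by rewrite x0E; have := xV N.+1 (leqnn _); rewrite subnn => ->.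
- have := xV 0%N (leq0n _); rewrite (_ : (2 * (N.+1 - 0) + 1 = (2 * N + 2).+1)%N); last by lia.
  by move=> ->; exact: (FD_velocity_left sol v10 (ltW t0)).
(* Odd [k] gives the equations of motion of the nodes, even [k] the time derivative of the
   strains. *)
have [ok|ek] := boolP (odd k).
  have [j jN kE] : exists2 j, (0 < j <= N.+1)%N & k = (2 * (N.+1 - j) + 1)%N.
    by exists (N.+1 - k./2)%N; have := odd_double_half k; rewrite ok; lia.
  have xk : x k = dv j by rewrite kE xV//; lia.
  have xk1 : x k.+1 = s *: (v j - v j.-1).
    rewrite (_ : k.+1 = 2 * (N - j.-1) + 2)%N; last by lia.
    by rewrite xS ?prednK//; lia.
  rewrite xk xk1; apply: (is_derive_eq (dvD j t _ t0)); first by lia.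
  (* The damped node is [k = 1], where the ghost value supplies the friction term. *)
  have [jN1|jN1] := eqVneq j N.+1.
    have -> : k.-1 = 0%N by lia.
    rewrite x0E jN1 !fctE /GRing.scale/=.
    have := FD_right sol (ltW t0); rewrite -/h /s /b -/h => Er.
    have -> : ddv N.+1 t = - (c ^+ 2 * ((v N.+1 t - v N t) / h ^+ 2)) -
        xi / h * dv N.+1 t by lra.
    by field; rewrite !gt_eqF.
  have -> : x k.-1 = s *: (v j.+1 - v j).
    rewrite (_ : k.-1 = 2 * (N - j) + 2)%N; last by lia.
    by rewrite xS//; lia.
  rewrite !fctE /GRing.scale/=.
  have /eqP := FD_interior sol (ltac:(lia) : (1 <= j <= N)%N) (ltW t0).
  rewrite subr_eq0 => /eqP ->; rewrite /s -/h.
  by field; rewrite gt_eqF.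
have [j jN kE] : exists2 j, (j <= N)%N & k = (2 * (N - j) + 2)%N.
  exists (N.+1 - k./2)%N; have := odd_double_half k; rewrite (negbTE ek); lia.
have xk : x k = s *: (v j.+1 - v j) by rewrite kE xS.
have xk1 : x k.+1 = dv j.
  by rewrite (_ : k.+1 = 2 * (N.+1 - j) + 1)%N ?xV//; lia.
have xk2 : x k.-1 = dv j.+1.
  by rewrite (_ : k.-1 = 2 * (N.+1 - j.+1) + 1)%N ?xV//; lia.
rewrite xk xk1 xk2.
have h1 := vD j.+1 t ltac:(lia) t0; have h2 := vD j t ltac:(lia) t0.
exact: (is_derive_eq (is_deriveZ s (is_deriveB h1 h2))).
Qed.

(** * Decay of the discrete energy and choice of the rate *)

Lemma FD_energy_right_continuous {R : realType} {c L xi : R} {N : nat}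
    {v0 v1 : 'rV[R]_N.+2} {v dv ddv : nat -> R -> R} :
  FD_solution c L xi v0 v1 v dv ddv ->
  energyFD c L N v dv t @[t --> 0^'+] --> energyFD c L N v dv 0.
Proof.
move=> sol.
have cv j : (j <= N.+1)%N -> v j t @[t --> 0^'+] --> v j 0.
  by move=> jN; apply: has_deriv_right_continuous (FD_velocity sol jN (lexx _)).
have cdv j : (j <= N.+1)%N -> dv j t @[t --> 0^'+] --> dv j 0.
  by move=> jN; apply: has_deriv_right_continuous (FD_acceleration sol jN (lexx _)).
have csum (f : nat -> R -> R) n :
    (forall j, (j < n)%N -> f j t @[t --> 0^'+] --> f j 0) ->
    \sum_(0 <= j < n) `|f j t| ^+ 2 @[t --> 0^'+] -->
    \sum_(0 <= j < n) `|f j 0| ^+ 2.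
  elim: n => [_|n IH fc].
    rewrite big_geq//.
    under eq_fun do rewrite big_geq//.
    exact: cvg_cst.
  rewrite big_nat_recr//=; under eq_fun do rewrite big_nat_recr//=.
  apply: cvgD; first by apply: IH => j jn; apply: fc; exact: ltnW.
  have /cvg_norm fn := fc n (ltnSn _).
  by rewrite expr2; under eq_fun do rewrite expr2; exact: cvgM.
apply: cvgD; apply: cvgM; do ?exact: cvg_cst.
  by apply: csum => j jN; exact: cdv.
apply: (csum (fun j t => (v j.+1 t - v j t) / mesh L N)) => j jN.
by apply: cvgM; [apply: cvgB; apply: cv; lia | exact: cvg_cst].
Qed.

(** Decay holds for every rate up to [d0], so that the rate can later be lowered to meet the
    explicit bounds. *)
Lemma FD_energy_decay {R : realType} (c L xi : R) (N : nat) :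
  0 < c -> 0 < L -> 0 < xi -> exists2 d0 : R, 0 < d0 &
  forall d : R, 0 <= d <= d0 ->
  forall (v0 v1 : 'rV[R]_N.+2) (v dv ddv : nat -> R -> R),
    v1 ord0 ord0 = 0 -> FD_solution c L xi v0 v1 v dv ddv ->
  forall t : R, 0 < t ->
    energyFD c L N v dv t <=
      expR (d * (L / c) - d * t) * energyFD c L N v dv 0.
Proof.
move=> c0 L0 xi0; have h0 : 0 < mesh L N by rewrite divr_gt0.
have T0 : 0 < L / c by rewrite divr_gt0.
have s0 : 0 < c / mesh L N by rewrite divr_gt0.
have b0 : 0 < xi / mesh L N by rewrite divr_gt0.
have m0 : (1 <= 2 * N + 2)%N by lia.
have [q q1 Hq] := damped_chain_contraction s0 b0 T0 m0.
exists ((1 - q) / (L / c)); first by rewrite divr_gt0 ?subr_gt0.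
move=> d /andP[d0]; rewrite ler_pdivlMr// => dT v0 v1 v dv ddv v10 sol t t0.
have hx := FD_chain_damped c0 L0 sol v10.
set x := FD_chain _ _ _ _ _ in hx.
have EE (a : R) : 0 <= a ->
    energyFD c L N v dv a = mesh L N / 2 * chain_energy (2 * N + 2) x a.
  move=> a0; apply: FD_chain_energy => //.
  exact: (FD_velocity_left sol v10 a0).
have decay (a : R) : 0 < a -> a <= t -> energyFD c L N v dv t <=
    expR (d * (L / c) - d * (t - a)) * energyFD c L N v dv a.
  move=> a0 at_; rewrite (EE t (ltW t0)) (EE a (ltW a0)) mulrCA.
  rewrite ler_pM2l ?divr_gt0//.
  apply: (@geometric_decay _ (chain_energy (2 * N + 2) x) _ q) => //.
  - exact: chain_energy_ge0.
  - by move=> u w u0 uw; apply: damped_chain_energy_nonincreasing s0 b0 hx u0 uw.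
  - by move=> u u0; exact: Hq.
have ce : expR (d * (L / c) - d * (t - a)) @[a --> 0^'+] -->
    expR (d * (L / c) - d * t).
  rewrite -[in X in _ --> X](subr0 t); apply: cvg_at_right_filter.
  apply: (@continuous_comp _ _ _ (fun a : R => d * (L / c) - d * (t - a)) expR).
    apply: cvgB; first exact: cvg_cst.
    apply: cvgM; first exact: cvg_cst.
    by apply: cvgB; [exact: cvg_cst | exact: cvg_id].
  exact: continuous_expR.
(* The decay from a starting time [a > 0] is passed to the limit [a -> 0+]. *)
apply: (cvgr_to_ge (cvgM ce (FD_energy_right_continuous sol))).
near=> a; apply: decay; first by near: a; exact: nbhs_right_gt.
by near: a; exact: nbhs_right_le.
Unshelve. all: by end_near.
Qed.

Lemma kappaFD_ge0 {R : realType} (c L xi : R) (N : nat) : 0 <= kappaFD c L xi N.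
Proof.
have [[l _ ->] _] := kappaFD_max c L xi N.
by rewrite mulr_ge0 ?sqr_ge0.
Qed.

Theorem theorem7 (R : realType) (c L xi : R) (N : nat)
    (c_gt0 : 0 < c) (L_gt0 : 0 < L) (xi_gt0 : 0 < xi) :
  exists delta : R,
    [/\ 0 < delta,
        delta < 2 * xi * c ^+ 2 /
          (L * (c ^+ 2 * (1 + 1 / (2 * N%:R + 2)) + xi ^+ 2)),
        2 * xi * c ^+ 2 /
          (L * (c ^+ 2 * (1 + 1 / (2 * N%:R + 2)) + xi ^+ 2))
          < 2 * xi * c ^+ 2 / (L * (c ^+ 2 + xi ^+ 2)) &
        forall v0 v1 : 'rV[R]_N.+2,
          v0 ord0 ord0 = 0 -> v1 ord0 ord0 = 0 ->
        forall v dv ddv : nat -> R -> R,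
          FD_solution c L xi v0 v1 v dv ddv ->
        forall t : R, 0 < t ->
          energyFD c L N v dv t <=
            (c + delta * L) / (c - delta * L) *
            expR (- delta * (1 - L * delta / c) *
                    (1 - kappaFD c L xi N / (4 * c ^+ 2)) * t) *
            energyFD c L N v dv 0].
Proof.
have c2 : 0 < c ^+ 2 by rewrite exprn_gt0.
have xi2 : 0 < xi ^+ 2 by rewrite exprn_gt0.
have N2 : 0 < 1 / (2 * N%:R + 2) :> R by rewrite divr_gt0// ltr_wpDl// mulr_ge0.
set r := 1 / (2 * N%:R + 2) in N2 *.
have num0 : 0 < 2 * xi * c ^+ 2 by rewrite !mulr_gt0.
have den0 : 0 < L * (c ^+ 2 + xi ^+ 2) by rewrite mulr_gt0 ?addr_gt0.
have den_lt : L * (c ^+ 2 + xi ^+ 2) < L * (c ^+ 2 * (1 + r) + xi ^+ 2).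
  by rewrite ltr_pM2l// ltrD2r ltr_pMr// ltrDl.
have bound0 : 0 < 2 * xi * c ^+ 2 / (L * (c ^+ 2 * (1 + r) + xi ^+ 2)).
  by rewrite divr_gt0// (lt_trans den0).
set bound := 2 * xi * c ^+ 2 / (L * (c ^+ 2 * (1 + r) + xi ^+ 2)) in bound0 *.
have [d0 d0_gt0 decay] := FD_energy_decay c L xi N c_gt0 L_gt0 xi_gt0.
(* [d0] gives the decay, the half of [bound] the strict upper bound, and [c / L / 2] the positivity
   of [c - delta * L]. *)
pose delta := Num.min d0 (Num.min (bound / 2) (c / L / 2)).
have delta_gt0 : 0 < delta by rewrite !lt_min d0_gt0 (divr_gt0 bound0) ?divr_gt0.
have dd0 : delta <= d0 by rewrite ge_min lexx.
have dbound : delta <= bound / 2 by rewrite !ge_min lexx orbT.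
have dcL : delta <= c / L / 2 by rewrite !ge_min lexx !orbT.
clearbody delta; exists delta; split => //.
- by apply: le_lt_trans dbound _; lra.
- by rewrite /bound ltr_pM2l// ltf_pV2// posrE// (lt_trans den0).
move=> v0 v1 _ v10 v dv ddv sol t t0.
have dd : 0 <= delta <= d0 by rewrite ltW.
apply: le_trans (decay delta dd v0 v1 v dv ddv v10 sol t t0) _.
have h0 : 0 <= mesh L N by rewrite divr_ge0// ltW.
have E0 : 0 <= energyFD c L N v dv 0.
  apply: addr_ge0; apply: mulr_ge0; try by apply: sumr_ge0 => j _; exact: sqr_ge0.
    by rewrite divr_ge0.
  by rewrite divr_ge0 ?(mulr_ge0 (ltW c2)).
apply: ler_wpM2r => //.
have dL : delta * L < c.
  rewrite -ltr_pdivlMr//; apply: le_lt_trans dcL _.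
  by have : 0 < c / L by [rewrite divr_gt0]; lra.
have dLc : 0 < delta * L by rewrite mulr_gt0.
(* The factor [exp (delta L / c)] is compared with the prefactor, and [exp (- delta t)] with the
   stated exponential. *)
rewrite expRD; apply: ler_pM; rewrite ?expR_ge0//.
  set y := delta * (L / c).
  have yE : y = delta * L / c by rewrite /y mulrA.
  have y1 : 0 < 1 - y by rewrite yE subr_gt0 ltr_pdivrMr// mul1r.
  apply: (@le_trans _ _ (1 - y)^-1).
    rewrite -[y in expR y]opprK expRN lef_pV2 ?posrE ?expR_gt0//.
    exact: expR_ge1Dx.
  have -> : (1 - y)^-1 = c / (c - delta * L).
    by rewrite yE; field; rewrite !gt_eqF// subr_gt0.
  by rewrite ler_pM2r ?invr_gt0 ?subr_gt0// lerDl ltW.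
(* It remains that [(1 - z) (1 - k) <= 1] for [0 <= z <= 1] and [k >= 0], with [z = L delta / c] and
   [k = kappaFD / (4 c ^ 2)]. *)
rewrite ler_expR !mulNr lerN2 ler_pM2r// -mulrA -[leRHS]mulr1 ler_pM2l//.
have z0 : 0 <= L * delta / c by rewrite divr_ge0 ?mulr_ge0 ?ltW.
have z1 : 0 <= 1 - L * delta / c.
  by rewrite subr_ge0 ler_pdivrMr// mul1r mulrC ltW.
have k0 : 0 <= kappaFD c L xi N / (4 * c ^+ 2).
  by rewrite divr_ge0 ?kappaFD_ge0// mulr_ge0// ltW.
by have := mulr_ge0 z1 k0; lra.
Qed.
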